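(* Let $R$ and $S$ be Morita equivalent unital rings. Then $R$ has Unbounded Generating Number if and only if $S$ has Unbounded Generating Number.
   Context: All rings are nonzero and associative with identity, and all modules are unitary. A ring $R$ is said to have Unbounded Generating Number (UGN) if, for each positive integer $m$, any set of generators for the free right $R$-module $R^m$ has cardinality $\geq m$. *)

(* Defs.v *)
From mathcomp Require Import all_boot all_algebra.
From mathcomp Require Import boolp classical_sets functions cardinality.

Set Implicit Arguments.
Unset Strict Implicit.
Unset Printing Implicit Defensive.

Import GRing.Theory.
Local Open Scope classical_set_scope.
Local Open Scope card_scope.
Local Open Scope ring_scope.

(* A right R-module is a left module over the converse ring R^c: there         *)
(* [a *: x] denotes the right action x.a, and (a * b in R^c) is b * a in R.     *)
Notation rmodType R := (lmodType R^c).

Definition generates (R : nzRingType) (V : rmodType R) (X : set V) : Prop :=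
  forall v : V, exists (n : nat) (x : 'I_n -> V) (a : 'I_n -> R^c),
    (forall i, X (x i)) /\ v = \sum_(i < n) a i *: x i.

(* The free right module R^m is 'cV[R^c]_m: R^c acts coordinatewise by          *)
(* multiplication in R^c, i.e. by right multiplication in R. The set X may be   *)
(* infinite; [`I_m #<= X] says that its cardinality is at least m.              *)
Definition UGN (R : nzRingType) : Prop :=
  forall m : nat, (0 < m)%N ->
  forall X : set 'cV[R^c]_m, generates X -> `I_m #<= X.

(* Functors Mod-R -> Mod-S. They are not required to be additive: an            *)
(* equivalence of module categories is so automatically.                        *)
Record rmodFunctor (R S : nzRingType) := RModFunctor {
  fobj :> rmodType R -> rmodType S;
  fmap : forall M N : rmodType R, {linear M -> N} -> {linear fobj M -> fobj N};
  fmap_id : forall M : rmodType R, fmap (idfun : {linear M -> M}) = idfun;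
  fmap_comp : forall (M N P : rmodType R)
      (g : {linear N -> P}) (f : {linear M -> N}),
    fmap (g \o f : {linear M -> P}) = (fmap g \o fmap f : {linear _ -> _}) }.

Definition idFunctor (R : nzRingType) : rmodFunctor R R :=
  @RModFunctor R R (fun M => M) (fun M N f => f)
    (fun M => erefl) (fun M N P g f => erefl).

Definition compFunctor (R S T : nzRingType)
    (G : rmodFunctor S T) (F : rmodFunctor R S) : rmodFunctor R T.
Proof.
refine (@RModFunctor R T (fun M => G (F M)) (fun M N f => fmap G (fmap F f)) _ _).
- by move=> M; rewrite !fmap_id.
- by move=> M N P g f; rewrite !fmap_comp.
Defined.

Definition nat_isomorphic (R S : nzRingType) (F G : rmodFunctor R S) : Prop :=
  exists eta : forall M : rmodType R, {linear F M -> G M},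
    (forall (M N : rmodType R) (f : {linear M -> N}),
       eta N \o fmap F f =1 fmap G f \o eta M)
    /\ (forall M : rmodType R, bijective (eta M)).

Definition Morita_equivalent (R S : nzRingType) : Prop :=
  exists (F : rmodFunctor R S) (G : rmodFunctor S R),
    nat_isomorphic (compFunctor G F) (idFunctor R)
    /\ nat_isomorphic (compFunctor F G) (idFunctor S).

(* Main.v *)
(* R fails UGN iff some n < m admits a split epimorphism R^n -> R^m, i.e.       *)
(* matrices of endomorphisms of R whose product is the identity; dropping to    *)
(* m = n + 1 and iterating gives R^n -> R^N for every N. An equivalence F is    *)
(* full and faithful, hence additive, hence preserves such matrix identities,   *)
(* so F(R)^n -> F(R)^N splits for all N. The trace ideal of a generator is the  *)
(* whole ring, which yields split epimorphisms S^l -> F(R) and F(R)^k -> S.     *)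
(* Altogether S^(ln) -> F(R)^n -> F(R)^(kN) -> S^N is a split epimorphism for   *)
(* every N, and N = ln + 1 shows that S fails UGN.                              *)

Require Import Defs.
From HB Require Import structures.
From mathcomp Require Import all_boot all_algebra.
From mathcomp Require Import boolp classical_sets functions cardinality.
Set Implicit Arguments.
Unset Strict Implicit.
Unset Printing Implicit Defensive.

Import GRing.Theory.
Local Open Scope card_scope.
Local Open Scope ring_scope.

(** A generating set of n elements of the free module R^m is a surjection R^n -> R^m, which splits
    because R^m is projective. So UGN says that split epimorphisms R^n -> R^m exist only for m <= n
    ([UGN_split_powerP]). Written as a matrix identity between linear maps ([split_power]), a
    splitting survives every full and faithful functor, since such a functor is additive ([fmapD],
    [fmap_split_power]). If UGN fails for R, then R^n maps onto every R^N ([split_power_grow]).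
    Applied to both functors, [split_power_trace] compares F(R) with S and carries the failure over
    to S ([Morita_equivalent_UGN]). *)

(** * Quotient modules *)

Section QuotientModule.
Variables (R : nzRingType) (V : lmodType R) (I : zmodClosed V).
Hypothesis IZ : forall a x, x \in I -> a *: x \in I.

(** The proof of stability under scaling is part of the type, so that the module structure can be
    inferred from the type alone. *)
Definition quotient_module of (forall a x, x \in I -> a *: x \in I) := Quotient.quot I.
HB.instance Definition _ := GRing.Zmodule.on (quotient_module IZ).

Definition quotient_pi (x : V) : (quotient_module IZ) := (\pi_(Quotient.quot I) x)%qT.
Definition quotient_scale (a : R) (x : (quotient_module IZ)) : (quotient_module IZ) :=
  quotient_pi (a *: repr x).

Lemma quotient_pi_eq x y : (quotient_pi x == quotient_pi y) = (x - y \in I).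
Proof. by rewrite Quotient.idealrBE. Qed.

Lemma quotient_piK x : quotient_pi (repr x) = x.
Proof. exact: reprK. Qed.

Lemma quotient_piZ a x : quotient_pi (a *: x) = quotient_scale a (quotient_pi x).
Proof.
apply/eqP; rewrite quotient_pi_eq -scalerBr IZ // -quotient_pi_eq.
by rewrite quotient_piK.
Qed.

Lemma quotient_piD x y : quotient_pi (x + y) = quotient_pi x + quotient_pi y.
Proof. exact: raddfD. Qed.

Lemma quotient_scaleA a b x :
  quotient_scale a (quotient_scale b x) = quotient_scale (a * b) x.
Proof. by rewrite -(quotient_piK x) -!quotient_piZ scalerA. Qed.

Lemma quotient_scale1 : left_id 1 quotient_scale.
Proof. by move=> x; rewrite -(quotient_piK x) -!quotient_piZ scale1r. Qed.

Lemma quotient_scaleDr : right_distributive quotient_scale +%R.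
Proof.
move=> a x y; rewrite -(quotient_piK x) -(quotient_piK y) -quotient_piD.
by rewrite -!quotient_piZ scalerDr quotient_piD.
Qed.

Lemma quotient_scaleDl x : {morph quotient_scale^~ x : a b / a + b}.
Proof.
by move=> a b; rewrite -(quotient_piK x) -!quotient_piZ scalerDl quotient_piD.
Qed.

HB.instance Definition _ := GRing.Zmodule_isLmodule.Build R (quotient_module IZ)
  quotient_scaleA quotient_scale1 quotient_scaleDr quotient_scaleDl.

Lemma quotient_pi_is_linear : linear quotient_pi.
Proof. by move=> a x y; rewrite quotient_piD quotient_piZ. Qed.
HB.instance Definition _ := GRing.isLinear.Build R V (quotient_module IZ) _ quotient_pi
  quotient_pi_is_linear.

End QuotientModule.

(** Classical logic makes the submodule [P] a boolean predicate, to which the quotient construction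
    applies. *)
Lemma quotient_exists (R : nzRingType) (V : lmodType R) (P : V -> Prop) :
  P 0 -> (forall a x y, P x -> P y -> P (a *: x + y)) ->
  exists (Q : lmodType R) (p : {linear V -> Q}), forall x, p x = 0 <-> P x.
Proof.
move=> P0 PD; pose I : pred V := fun x => `[< P x >].
have Icl : zmod_closed I.
  split=> [|x y /asboolP Px /asboolP Py]; apply/asboolP=> //.
  by rewrite addrC -scaleN1r; apply: PD.
pose IC := GRing.isZmodClosed.Build V I Icl.
pose I' : zmodClosed V := HB.pack I IC.
have IZ a x : x \in I' -> a *: x \in I'.
  by move=> /asboolP Px; apply/asboolP; rewrite -[_ *: _]addr0; apply: PD.
exists (quotient_module IZ), (@quotient_pi R V I' IZ) => x.
rewrite -(linear0 (@quotient_pi R V I' IZ)).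
by rewrite (rwP eqP) quotient_pi_eq subr0; split=> /asboolP.
Qed.

(** Function extensionality and irrelevance of linearity proofs. Functor laws are equations between
    bundled maps; this makes them usable for maps known pointwise. *)
Lemma linear_eq (R : nzRingType) (A B : lmodType R) (f g : {linear A -> B}) :
  f =1 g -> f = g.
Proof.
case: f g => f cf [g cg] /= fg.
have {}fg : f = g by apply/funext.
subst g; congr GRing.Linear.Pack.
case: cf cg => [[a] [b]] [[c] [d]].
by rewrite (Prop_irrelevance a c) (Prop_irrelevance b d).
Qed.

Lemma linear_inverse (R : nzRingType) (A B : lmodType R) (f : {linear A -> B}) :
  bijective f -> exists g : {linear B -> A}, cancel f g /\ cancel g f.
Proof.
case=> g fK gK; have gL : linear g.
  by move=> a x y; apply: (can_inj fK); rewrite linearP !gK.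
by exists (HB.pack_for {linear B -> A} g (GRing.isLinear.Build R B A _ g gL)).
Qed.

(** * Full and faithful functors are additive *)

Section Functor.
Variables (R S : nzRingType) (F : rmodFunctor R S).

Lemma fmap_compE (A B C : rmodType R) (g : {linear B -> C}) (f : {linear A -> B})
    (h : {linear A -> C}) : (forall x, h x = g (f x)) ->
  forall y, fmap F h y = fmap F g (fmap F f y).
Proof.
by move=> hE y; rewrite (_ : h = (g \o f : {linear A -> C})) ?fmap_comp //; apply: linear_eq.
Qed.

Lemma fmap_idE (A : rmodType R) (h : {linear A -> A}) : h =1 id -> fmap F h =1 id.
Proof.
move=> hE y; rewrite (_ : h = (idfun : {linear A -> A})) ?fmap_id //.
exact: linear_eq.
Qed.

Definition full := forall (A B : rmodType R) (h : {linear F A -> F B}),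
  exists f : {linear A -> B}, fmap F f =1 h.

Definition faithful := forall (A B : rmodType R) (f g : {linear A -> B}),
  fmap F f =1 fmap F g -> f =1 g.

Hypotheses (Ffull : full) (Ffaithful : faithful).

(** The zero module Z has a single endomorphism, hence by fullness so has F(Z), and F(Z) = 0. A zero
    map factors through Z. *)
Lemma fmap0 (A B : rmodType R) (h : {linear A -> B}) :
  (forall x, h x = 0) -> forall y, fmap F h y = 0.
Proof.
move=> h0 y; pose Z : rmodType R := 'rV[R^c]_0.
have FZ0 (z : F Z) : z = 0.
  have [f fE] := Ffull (\0 : {linear F Z -> F Z}).
  have /fmap_idE/(_ z) : f =1 id by move=> x; apply/rowP; case.
  by rewrite fE.
pose u : {linear A -> Z} := \0; pose v : {linear Z -> B} := \0.
by rewrite (@fmap_compE A Z B v u h) ?h0 // [fmap F u y]FZ0 linear0.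
Qed.

(** The sum f + g is the pairing [t] into B * B followed by the addition [s]. It is therefore enough
    that F(e1) + F(e2) is the identity of F(B * B). *)
Lemma fmapD (A B : rmodType R) (f g h : {linear A -> B}) :
  (forall x, h x = f x + g x) -> forall y, fmap F h y = fmap F f y + fmap F g y.
Proof.
move=> hE y; pose P : rmodType R := (B * B)%type.
pose p1 : {linear P -> B} := fst; pose p2 : {linear P -> B} := snd.
have i1L : linear (fun b : B => (b, 0) : P).
  by move=> a u v; congr pair; rewrite /= scaler0 addr0.
have i2L : linear (fun b : B => (0, b) : P).
  by move=> a u v; congr pair; rewrite /= scaler0 addr0.
pose i1 : {linear B -> P} := HB.pack (fun b : B => (b, 0) : P)
  (GRing.isLinear.Build _ _ _ _ _ i1L).
pose i2 : {linear B -> P} := HB.pack (fun b : B => (0, b) : P)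
  (GRing.isLinear.Build _ _ _ _ _ i2L).
have tL : linear (fun a : A => (f a, g a) : P).
  by move=> a u v; rewrite !linearP.
pose t : {linear A -> P} := HB.pack (fun a : A => (f a, g a) : P)
  (GRing.isLinear.Build _ _ _ _ _ tL).
pose s : {linear P -> B} := (p1 \+ p2 : {linear P -> B}).
pose e1 : {linear P -> P} := i1 \o p1; pose e2 : {linear P -> P} := i2 \o p2.
(* By fullness the sum is F(e) for some [e]; by faithfulness [e] commutes with both projections, so
   it is the identity. *)
have [e eE] := Ffull (fmap F e1 \+ fmap F e2 : {linear F P -> F P}).
have p1e : (p1 \o e : {linear P -> B}) =1 p1.
  apply: Ffaithful => z; rewrite fmap_comp /= eE /= linearD.
  rewrite -(@fmap_compE _ _ _ p1 e1 p1) //.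
  by rewrite -(@fmap_compE _ _ _ p1 e2 \0) // (@fmap0 _ _ \0) ?addr0.
have p2e : (p2 \o e : {linear P -> B}) =1 p2.
  apply: Ffaithful => z; rewrite fmap_comp /= eE /= linearD.
  rewrite -(@fmap_compE _ _ _ p2 e2 p2) //.
  by rewrite -(@fmap_compE _ _ _ p2 e1 \0) // (@fmap0 _ _ \0) ?add0r.
have e_id : e =1 id.
  by move=> x; rewrite [e x]surjective_pairing [RHS]surjective_pairing -(p1e x) -(p2e x).
rewrite (@fmap_compE _ _ _ s t h) // -[fmap F t y](fmap_idE e_id) eE /= linearD.
rewrite -(@fmap_compE _ _ _ s e1 p1) => [|x]; last by rewrite /= addr0.
rewrite -(@fmap_compE _ _ _ s e2 p2) => [|x]; last by rewrite /= add0r.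
by rewrite -(@fmap_compE _ _ _ p1 t f) // -(@fmap_compE _ _ _ p2 t g).
Qed.

Lemma fmap_sum (A B : rmodType R) (I : Type) (r : seq I) (f : I -> {linear A -> B})
    (h : {linear A -> B}) : (forall x, h x = \sum_(i <- r) f i x) ->
  forall y, fmap F h y = \sum_(i <- r) fmap F (f i) y.
Proof.
elim: r h => [|i r IHr] h hE y.
  by rewrite big_nil; apply: fmap0 => x; rewrite hE big_nil.
rewrite big_cons -(IHr (h \- f i : {linear A -> B})) => [|x].
  by apply: fmapD => x; rewrite /= addrC subrK.
by rewrite /= hE big_cons addrC addKr.
Qed.

End Functor.

(** * Equivalences are full and faithful *)

Section Equivalence.
Variables (R S : nzRingType) (F : rmodFunctor R S) (G : rmodFunctor S R).

Lemma equivalence_faithful :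
  nat_isomorphic (compFunctor G F) (idFunctor R) -> faithful F.
Proof.
case=> eta [eta_nat eta_bij] A B f g fg x.
have [k _ kK] := eta_bij A.
rewrite -[x]kK -[f _](eta_nat A B f) -[g _](eta_nat A B g) /=.
by congr (eta B (fmap G _ _)); apply: linear_eq.
Qed.

(** Conjugating G(h) by the natural isomorphism gives [f] with G(F(f)) = G(h), and G is faithful. *)
Lemma equivalence_full :
  nat_isomorphic (compFunctor G F) (idFunctor R) -> faithful G -> full F.
Proof.
case=> eta [eta_nat eta_bij] Gfaithful A B h.
have [k [etaK kK]] := linear_inverse (eta_bij A).
pose f : {linear A -> B} := eta B \o fmap G h \o k.
exists f; apply: Gfaithful => x.
have [l lK _] := eta_bij B; apply: (can_inj lK).
by have /= -> := eta_nat A B f x; rewrite /= etaK.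
Qed.

End Equivalence.

(* [f] and [g] are matrices of linear maps with [f g] the identity matrix: they *)
(* exhibit [A^I -> B^J] as a split epimorphism.                                 *)
Definition split_power (R : nzRingType) (I : finType) (A : lmodType R)
    (J : finType) (B : lmodType R) : Prop :=
  exists (f : J -> I -> {linear A -> B}) (g : I -> J -> {linear B -> A}),
    forall j k b, \sum_i f j i (g i k b) = if j == k then b else 0.

(** * Calculus of split epimorphisms between powers *)

Section SplitPower.
Variable R : nzRingType.
Implicit Types (I J K : finType) (A B C : lmodType R).

Lemma split_power_trans I A J B K C :
  split_power I A J B -> split_power J B K C -> split_power I A K C.
Proof.
case=> f [g fgE] [f' [g' fgE']].
have F_lin k i : linear (fun a => \sum_j f' k j (f j i a)).
  move=> c u v; rewrite scaler_sumr -big_split /=; apply: eq_bigr => j _.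
  by rewrite !linearP.
have G_lin i k : linear (fun c => \sum_j g i j (g' j k c)).
  move=> c u v; rewrite scaler_sumr -big_split /=; apply: eq_bigr => j _.
  by rewrite !linearP.
pose F k i : {linear A -> C} := HB.pack (fun a => \sum_j f' k j (f j i a))
  (GRing.isLinear.Build _ _ _ _ _ (F_lin k i)).
pose G i k : {linear C -> A} := HB.pack (fun c => \sum_j g i j (g' j k c))
  (GRing.isLinear.Build _ _ _ _ _ (G_lin i k)).
exists F, G => k l c; rewrite -fgE' /= exchange_big /=; apply: eq_bigr => j _.
rewrite -linear_sum; congr (f' k j _).
under eq_bigr do rewrite linear_sum.
rewrite exchange_big (bigD1 j) //= fgE eqxx big1 ?addr0 // => j' j'j.
by rewrite fgE eq_sym (negPf j'j).
Qed.

(** Pad with zeros outside the image of [s] and keep only the targets selected by [t]. *)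
Lemma split_power_reindex I I' A J J' B (s : I -> I') (t : J' -> J) :
  injective s -> injective t -> split_power I A J B -> split_power I' A J' B.
Proof.
move=> s_inj t_inj [f [g fgE]].
pose f' j i' : {linear A -> B} := if [pick i | s i == i'] is Some i then f (t j) i else \0.
pose g' i' j : {linear B -> A} := if [pick i | s i == i'] is Some i then g i (t j) else \0.
have pickE i : [pick k | s k == s i] = Some i.
  by case: pickP => [k /eqP/s_inj->//|/(_ i)]; rewrite eqxx.
exists f', g' => j k b; rewrite -(inj_eq t_inj) -fgE.
rewrite (bigID (mem (codom s))) /= [X in _ + X]big1 => [|i' i'Ns]; last first.
  rewrite /f' /g'; case: pickP => //= i /eqP sE.
  by rewrite -sE codom_f in i'Ns.
rewrite addr0 (reindex_omap s (fun i' => [pick i | s i == i'])) /=; last first.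
  by move=> i' /codomP[i ->]; rewrite pickE.
by apply: eq_big => [i|i _]; rewrite ?codom_f ?pickE ?eqxx // /f' /g' pickE.
Qed.

Lemma split_power_card I I' A J J' B :
  (#|I| <= #|I'|)%N -> (#|J'| <= #|J|)%N ->
  split_power I A J B -> split_power I' A J' B.
Proof.
have inj (X Y : finType) : (#|X| <= #|Y|)%N -> exists s : X -> Y, injective s.
  move=> XY; exists (fun x => enum_val (widen_ord XY (enum_rank x))) => x y.
  by move=> /enum_val_inj/(congr1 val)/= /ord_inj/enum_rank_inj.
by move=> /inj[s s_inj] /inj[t t_inj]; apply: split_power_reindex s_inj t_inj.
Qed.

(** Block-diagonal sum with the identity matrix on [K]. *)
Lemma split_power_sum I A J K :
  split_power I A J A -> split_power (I + K)%type A (J + K)%type A.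
Proof.
case=> f [g fgE].
pose f' (j : J + K) (i : I + K) : {linear A -> A} :=
  match j, i with
  | inl j, inl i => f j i
  | inr k, inr k' => if k == k' then (idfun : {linear A -> A}) else \0
  | _, _ => \0
  end.
pose g' (i : I + K) (j : J + K) : {linear A -> A} :=
  match i, j with
  | inl i, inl j => g i j
  | inr k, inr k' => if k == k' then (idfun : {linear A -> A}) else \0
  | _, _ => \0
  end.
exists f', g' => j l b; rewrite big_sumType /=.
case: j l => j [l|l] /=.
- by rewrite fgE [X in _ + X]big1 ?addr0.
- by rewrite !big1 ?addr0 // => i _; rewrite linear0.
- by rewrite !big1 ?addr0 // => i _; rewrite linear0.
rewrite big1 // add0r (bigD1 j) //= eqxx big1 ?addr0 => [|i ij].
  by rewrite (_ : (inr j == inr l :> J + K) = (j == l)) //; case: (j == l).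
by rewrite eq_sym (negPf ij).
Qed.

(** Kronecker product with the identity matrix on [K]. *)
Lemma split_power_prod I A J B K :
  split_power I A J B -> split_power (I * K)%type A (J * K)%type B.
Proof.
case=> f [g fgE].
pose f' (j : J * K) (i : I * K) : {linear A -> B} :=
  if j.2 == i.2 then f j.1 i.1 else \0.
pose g' (i : I * K) (j : J * K) : {linear B -> A} :=
  if i.2 == j.2 then g i.1 j.1 else \0.
exists f', g' => -[j k] [l m] b.
rewrite -(pair_bigA _ (fun i n => f' (j, k) (i, n) (g' (i, n) (l, m) b))) /=.
transitivity (\sum_i if k == m then f j i (g i l b) else 0).
  apply: eq_bigr => i _; rewrite (bigD1 k) //= /f' /g' /= eqxx.
  rewrite big1 ?addr0 => [|n nk]; last by rewrite eq_sym (negPf nk).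
  by case: ifP => //= _; rewrite linear0.
rewrite xpair_eqE; case: (k == m); last by rewrite big1_eq andbF.
by rewrite andbT fgE.
Qed.

(** Adding k identity blocks to n -> n + 1 gives n + k -> n + k + 1, which extends n -> n + k by
    one. *)
Lemma split_power_grow n A :
  split_power 'I_n A 'I_n.+1 A -> forall m, split_power 'I_n A 'I_m A.
Proof.
move=> An m; suff An_add k : split_power 'I_n A 'I_(n + k) A.
  by apply: split_power_card (An_add m); rewrite !card_ord // leq_addl.
elim: k => [|k IHk].
  by apply: split_power_card An; rewrite !card_ord ?addn0.
apply: split_power_trans IHk _.
apply: split_power_card (split_power_sum 'I_k An);
  by rewrite card_sum !card_ord // addnS.
Qed.

End SplitPower.

(** * Images under functors, and trace ideals *)

Lemma fmap_split_power (R S : nzRingType) (F : rmodFunctor R S) (I J : finType)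
    (A B : rmodType R) :
  full F -> faithful F -> split_power I A J B -> split_power I (F A) J (F B).
Proof.
move=> Ffull Ffaithful [f [g fgE]].
exists (fun j i => fmap F (f j i)), (fun i j => fmap F (g i j)) => j k b.
(* The entry (j, k) of the identity matrix, as a linear map. *)
pose h : {linear B -> B} := if j == k then (idfun : {linear B -> B}) else \0.
transitivity (fmap F h b); last first.
  by rewrite /h; case: ifP => _; [apply: fmap_idE | apply: fmap0].
rewrite (@fmap_sum _ _ F Ffull Ffaithful B B I (index_enum I)
  (fun i => f j i \o g i k : {linear B -> B})) => [|x].
  by apply: eq_bigr => i _; rewrite fmap_comp.
by rewrite /h /= fgE; case: ifP.
Qed.

(* The trace ideal of [Q] in [R] is all of [R]: otherwise the projection [p] of *)
(* [R] onto the quotient by it is nonzero but kills every map [Q -> R], hence   *)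
(* [F p] kills every map [S -> F R].                                            *)
Lemma split_power_trace (R S : nzRingType) (F : rmodFunctor R S) (Q : rmodType R)
    (e : {linear F Q -> S^c^o}) :
  full F -> faithful F -> (exists z, e z = 1) ->
  exists l, split_power 'I_l Q 'I_1 (R^c^o : rmodType R).
Proof.
move=> Ffull Ffaithful [z ez]; pose U : rmodType R := R^c^o.
pose tr (r : U) := exists s : seq ({linear Q -> U} * Q), r = \sum_(x <- s) x.1 x.2.
have tr0 : tr 0 by exists [::]; rewrite big_nil.
have trP a x y : tr x -> tr y -> tr (a *: x + y).
  move=> [s ->] [s' ->]; exists ([seq (u.1, a *: u.2) | u <- s] ++ s').
  rewrite big_cat big_map scaler_sumr; congr (_ + _).
  by apply: eq_bigr => u _; rewrite linearZ.
have [M [p pE]] := quotient_exists tr0 trP.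
have p0 : p =1 (\0 : {linear U -> M}).
  apply: Ffaithful => y; rewrite [RHS](fmap0 Ffull) //.
  have uL : linear (fun s : S^c^o => s *: y).
    by move=> a s t; rewrite scalerDl scalerA.
  pose u : {linear S^c^o -> F U} := HB.pack (fun s : S^c^o => (s : S^c) *: y)
    (GRing.isLinear.Build _ _ _ _ _ uL).
  (* Fullness lifts s |-> s *: y, precomposed with [e], to a map Q -> R. Since e z = 1, [y] is in
     the image of F(f), which F(p) kills. *)
  have [f fE] := Ffull _ _ (u \o e : {linear F Q -> F U}).
  have -> : y = fmap F f z by rewrite fE /= ez scale1r.
  rewrite -(@fmap_compE _ _ F _ _ _ p f \0) ?(fmap0 Ffull) // => q.
  by apply/esym/pE; exists [:: (f, q)]; rewrite big_seq1.
have [s s1] : tr 1 by apply/pE; rewrite p0.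
have gL (x : Q) : linear (fun r : U => (r : R^c) *: x).
  by move=> a r t; rewrite scalerDl scalerA.
pose g x : {linear U -> Q} := HB.pack (fun r : U => (r : R^c) *: x)
    (GRing.isLinear.Build _ _ _ _ _ (gL x)).
(* A relation 1 = sum of f_i(q_i) is a split epimorphism Q^l -> R with right inverse r |-> (q_i
   r). *)
exists (size s), (fun _ i => (tnth (in_tuple s) i).1).
exists (fun i _ => g (tnth (in_tuple s) i).2) => j k b.
rewrite [j]ord1 [k]ord1 eqxx /=.
under eq_bigr do rewrite linearZ.
rewrite -scaler_sumr (_ : \sum_i _ = 1); first exact: mulr1.
by rewrite [RHS]s1 [RHS]big_tnth.
Qed.

(** * UGN in terms of split epimorphisms *)

(** The columns of a split epimorphism generate the target. Conversely, a finite generating set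
    expresses the standard basis, and the coefficients form a right inverse. *)
Lemma UGN_split_powerP (R : nzRingType) :
  UGN R <-> forall n m, split_power 'I_n (R^c^o : rmodType R) 'I_m (R^c^o : rmodType R) ->
    (m <= n)%N.
Proof.
split=> [ugn n [//|m] [f [g fgE]] | rank_le m _ X genX].
  (* The image of the i-th basis vector under [f]; applying [g] to [v] supplies the coefficients of
     [v]. *)
  pose x (i : 'I_n) : 'cV[R^c]_m.+1 := \col_j f j i (1 : R^c).
  have genX : generates (x @` [set: 'I_n])%classic.
    move=> v; exists n, x, (fun i => \sum_k (g i k (v k 0) : R^c)).
    split=> [i|]; first by exists i.
    apply/colP => j; rewrite summxE.
    transitivity (\sum_k \sum_i f j i (g i k (v k 0))).
      under [RHS]eq_bigr do rewrite fgE.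
      rewrite (bigD1 j) //= eqxx big1 ?addr0 // => k kj.
      by rewrite eq_sym (negPf kj).
    rewrite exchange_big; apply: eq_bigr => i _ /=.
    rewrite -linear_sum !mxE -[X in f j i X = _]mulr1.
    exact: (linearZ_LR (f j i)).
  rewrite -card_le_II; apply: card_le_trans (ugn m.+1 isT _ genX) _.
  by rewrite (card_le_eqr card_II) card_image_le.
(* An infinite [X] embeds the natural numbers, which settles that case. *)
have [/finite_seqP[s0 XE]|/infiniteP] := pselect (finite_set X); last first.
  by apply: card_le_trans; apply: subset_card_le.
pose s := undup s0; have Xs v : X v <-> v \in s by rewrite mem_undup XE.
suff ms : (m <= size s)%N.
  apply: card_le_trans (card_image_le (index^~ s) X); apply: subset_card_le => i /= im.
  have {}ms := leq_trans im ms.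
  by exists (nth 0 s i); [apply/Xs/mem_nth | rewrite index_uniq ?undup_uniq].
have span_s v : exists b : 'I_(size s) -> R^c, v = \sum_k b k *: nth 0 s k.
  have [p [x [a [Xx ->]]]] := genX v.
  (* An element of [X] may occur several times among the [x i]; its coefficients are added up. *)
  exists (fun k => \sum_(i | x i == nth 0 s k) a i).
  under [RHS]eq_bigr do rewrite scaler_suml.
  rewrite (exchange_big_dep xpredT) //=; apply: eq_bigr => i _.
  have xs : x i \in s by apply/Xs.
  have xi : (index (x i) s < size s)%N by rewrite index_mem.
  rewrite (big_pred1 (Ordinal xi)) /= ?nth_index // => k.
  apply/eqP/eqP => [xk|->]; last by rewrite /= nth_index.
  by apply/val_inj; rewrite /= xk index_uniq ?undup_uniq.
have /boolp.choice[a aE] (j : 'I_m) := span_s (\col_i (i == j)%:R).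
(* In R this is left multiplication by [c], hence right linear. *)
have fL (c : R^c) : linear (fun b : R^c^o => b * c : R^c^o).
  by move=> u v w; rewrite mulrDl -mulrA.
pose f c : {linear R^c^o -> R^c^o} :=
  HB.pack (fun b : R^c^o => b * c : R^c^o) (GRing.isLinear.Build _ _ _ _ _ (fL c)).
apply: rank_le; exists (fun j (k : 'I_(size s)) => f (nth 0 s k j 0)), (fun k j => f (a j k)).
move=> j k b /=; under eq_bigr do rewrite -mulrA.
rewrite -mulr_sumr; have /colP/(_ j) := aE k; rewrite mxE summxE => jkE.
rewrite (eq_bigr (fun i => (a k i *: nth 0 s i) j 0)) => [|i _]; last by rewrite mxE.
by rewrite -jkE; case: (j == k); rewrite ?mulr1 ?mulr0.
Qed.

(** * Morita invariance *)

Lemma split_power_iso (R : nzRingType) (I : finType) (A B : lmodType R)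
    (h : {linear A -> B}) : bijective h -> split_power I A I B.
Proof.
move=> /linear_inverse[k [_ kK]].
pose f (i j : I) : {linear A -> B} := if i == j then h else \0.
pose g (i j : I) : {linear B -> A} := if i == j then k else \0.
exists f, g => i j b; rewrite (bigD1 i) //= big1 ?addr0 => [|l li].
  by rewrite /f /g eqxx; case: (i == j); rewrite /= ?kK ?linear0.
by rewrite /f eq_sym (negPf li).
Qed.

Lemma Morita_equivalent_UGN (R S : nzRingType) :
  Morita_equivalent R S -> UGN S -> UGN R.
Proof.
move=> [F [G [GF FG]]] /UGN_split_powerP rank_S; apply/UGN_split_powerP => n m nm.
set U : rmodType R := R^c^o in nm; pose V : rmodType S := S^c^o.
have Ffaithful := equivalence_faithful GF; have Gfaithful := equivalence_faithful FG.
have Ffull := equivalence_full GF Gfaithful; have Gfull := equivalence_full FG Ffaithful.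
rewrite leqNgt; apply/negP => n_lt_m.
have surj A B (h : A -> B) y : bijective h -> exists x, h x = y.
  by case=> k _ kK; exists (k y).
have [eta [_ eta_bij]] := GF; have [eps [_ eps_bij]] := FG.
(* Since F(G(S)) is isomorphic to S, the trace argument applies to G(S) and splits G(S)^l -> R;
   symmetrically, F(R)^k -> S splits. *)
have [l lE] := split_power_trace Ffull Ffaithful (surj _ _ (eps V) _ (eps_bij V)).
have [k kE] := split_power_trace Gfull Gfaithful (surj _ _ (eta U) _ (eta_bij U)).
have [d [epsK dK]] := linear_inverse (eps_bij V).
have VF : split_power 'I_l V 'I_1 (F U).
  apply: split_power_trans (fmap_split_power Ffull Ffaithful lE).
  by apply: (@split_power_iso _ _ _ _ d); exists (eps V).
pose N := (l * n).+1.
have nN : split_power 'I_n (F U) 'I_(k * N) (F U).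
  apply: fmap_split_power => //; apply: split_power_grow.
  (* As n < m, it suffices to keep n + 1 of the m targets. *)
  by apply: split_power_card nm; rewrite !card_ord.
suff /rank_S : split_power 'I_(l * n) V 'I_N V by rewrite ltnn.
apply: split_power_trans (_ : split_power 'I_(l * n) V 'I_n (F U)) _.
  by apply: split_power_card (split_power_prod 'I_n VF); rewrite card_prod !card_ord ?mul1n.
apply: split_power_trans nN _.
by apply: split_power_card (split_power_prod 'I_N kE); rewrite card_prod !card_ord ?mul1n.
Qed.

Theorem theorem2p8 (R S : nzRingType) :
  Morita_equivalent R S -> (UGN R <-> UGN S).
Proof.
move=> RS; split; last exact: Morita_equivalent_UGN.
by apply: Morita_equivalent_UGN; case: RS => F [G [GF FG]]; exists G, F.
Qed.
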